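(* Let $n\ge 2$, let $\mathscr{C}_H\subseteq\mathbb{F}_2^{2^n-1}$ be the $[2^n-1,\,2^n-1-n,\,3]$ Hamming code and let $\mathbf{v}_1,\ldots,\mathbf{v}_{|\mathcal{C}_e|}$ be the elements of $\mathcal{C}_e$, the set of even-weight codewords, where $|\mathcal{C}_e|=2^{2^n-n-2}$. Let $G_4=(\mathcal{C}_e,\mathcal{E}_4)$ be the graph with $\{\mathbf{v}_i,\mathbf{v}_j\}\in\mathcal{E}_4$ iff $d_H(\mathbf{v}_i,\mathbf{v}_j)=4$, and let $A$ be its adjacency matrix. Let $\mathbf{p}\in\mathbb{F}_2^2$ with bitwise complement $\bar{\mathbf{p}}$, so that $\{\mathbf{p},\bar{\mathbf{p}}\}$ is one of $P_e=\{00,11\}$ and $P_o=\{01,10\}$. For a parity assignment $\pi:\mathcal{C}_e\to\{\mathbf{p},\bar{\mathbf{p}}\}$ define the cut vector $\mathbf{z}\in\{+1,-1\}^{|\mathcal{C}_e|}$ by $z_i=+1$ if $\pi(\mathbf{v}_i)=\mathbf{p}$ and $z_i=-1$ if $\pi(\mathbf{v}_i)=\bar{\mathbf{p}}$. Then the number of same-parity pairs in $\mathcal{E}_4$, i.e. of edges $\{\mathbf{v}_i,\mathbf{v}_j\}\in\mathcal{E}_4$ with $\pi(\mathbf{v}_i)=\pi(\mathbf{v}_j)$, is minimized (over all assignments $\pi:\mathcal{C}_e\to\{\mathbf{p},\bar{\mathbf{p}}\}$) if and only if $\mathbf{z}$ minimizes $\mathbf{z}^\top A\mathbf{z}$ (over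 $\{+1,-1\}^{|\mathcal{C}_e|}$).
   Context: The $[2^n-1,\,2^n-1-n,\,3]$ Hamming code is the kernel over $\mathbb{F}_2$ of an $n\times(2^n-1)$ matrix whose columns are all the nonzero vectors of $\mathbb{F}_2^n$, each appearing once. $d_H$ is Hamming distance. The rows and columns of $A$ are indexed according to the ordering $\mathbf{v}_1,\ldots,\mathbf{v}_{|\mathcal{C}_e|}$. *)

(* Defs.v *)
From mathcomp Require Export all_boot all_order all_algebra.

Set Implicit Arguments.
Unset Strict Implicit.
Unset Printing Implicit Defensive.

Import Order.TTheory GRing.Theory Num.Theory.
Local Open Scope ring_scope.

(* The boolean v != 0 is read as the multiplicity (0 or 1) of v as a column. *)
Definition hamming_check_matrix (n : nat) (H : 'M['F_2]_(n, 2 ^ n - 1)) : Prop :=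
  forall v : 'cV['F_2]_n, #|[set j | col j H == v]| = (v != 0) :> nat.

Definition code (n m : nat) (H : 'M['F_2]_(n, m)) : {set 'rV['F_2]_m} :=
  [set x | H *m x^T == 0].

Definition wt (m : nat) (x : 'rV['F_2]_m) : nat := #|[set j | x 0 j != 0]|.

Definition dH (m : nat) (x y : 'rV['F_2]_m) : nat :=
  #|[set j | x 0 j != y 0 j]|.

Definition even_code (n m : nat) (H : 'M['F_2]_(n, m)) : {set 'rV['F_2]_m} :=
  [set x in code H | ~~ odd (wt x)].

Definition enumeration (T : finType) (S : {set T}) (v : 'I_#|S| -> T) : Prop :=
  injective v /\ forall x, x \in S <-> exists i, v i = x.

Section Graph.
Variables (m : nat) (S : {set 'rV['F_2]_m}).

(* Edges are unordered pairs, so each one is counted once. *)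
Definition edges4 : {set {set 'rV['F_2]_m}} :=
  [set [set x; y] | x in S, y in S & dH x y == 4].

Definition adjacency4 (v : 'I_#|S| -> 'rV['F_2]_m) : 'M[int]_#|S| :=
  \matrix_(i, j) ([set v i; v j] \in edges4)%:R.

Definition parity_bar (p : 'rV['F_2]_2) : 'rV['F_2]_2 := p + const_mx 1.

(* Values outside S are irrelevant: only pi on S enters what follows. *)
Definition parity_assignment (p : 'rV['F_2]_2)
    (pi : 'rV['F_2]_m -> 'rV['F_2]_2) : Prop :=
  forall x, x \in S -> pi x \in [set p; parity_bar p].

Definition same_parity_edges (pi : 'rV['F_2]_m -> 'rV['F_2]_2) :
    {set {set 'rV['F_2]_m}} :=
  [set e in edges4 | [forall x in e, forall y in e, pi x == pi y]].

Definition cut_vector (v : 'I_#|S| -> 'rV['F_2]_m) (p : 'rV['F_2]_2)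
    (pi : 'rV['F_2]_m -> 'rV['F_2]_2) : 'cV[int]_#|S| :=
  \col_i (if pi (v i) == p then 1 else -1).

End Graph.

Definition bits (a b : 'F_2) : 'rV['F_2]_2 := \row_j (if j == 0 then a else b).
Definition P_even : {set 'rV['F_2]_2} := [set bits 0 0; bits 1 1].
Definition P_odd : {set 'rV['F_2]_2} := [set bits 0 1; bits 1 0].

Definition sign_vector (N : nat) (z : 'cV[int]_N) : Prop :=
  forall i, z i 0 = 1 \/ z i 0 = -1.

Definition quad_form (N : nat) (A : 'M[int]_N) (z : 'cV[int]_N) : int :=
  (z^T *m A *m z) 0 0.

Definition minimizes_same_parity (m : nat) (S : {set 'rV['F_2]_m})
    (p : 'rV['F_2]_2) (pi : 'rV['F_2]_m -> 'rV['F_2]_2) : Prop :=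
  parity_assignment S p pi /\
  forall pi', parity_assignment S p pi' ->
    (#|same_parity_edges S pi| <= #|same_parity_edges S pi'|)%N.

Definition minimizes_quad_form (N : nat) (A : 'M[int]_N) (z : 'cV[int]_N) : Prop :=
  sign_vector z /\
  forall w, sign_vector w -> quad_form A z <= quad_form A w.

(* Main.v *)
(** The even-weight codewords form the kernel of [H] extended by an all-one row, a
    matrix of full rank [n + 1], whence their number. For the cut vector [z] of an
    assignment, [z_i * z_j] is [1] on same-parity pairs and [-1] on the others, so,
    each edge being met by two ordered pairs,
    [z^T A z = 4 * #same-parity edges - 2 * #edges]. Since every sign vector is the
    cut vector of some assignment, both problems have the same minimizers. *)
Require Import Defs.
From mathcomp Require Import all_boot all_order all_algebra.
From mathcomp Require Import mxabelem ring.

Set Implicit Arguments.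
Unset Strict Implicit.
Unset Printing Implicit Defensive.

Import Order.TTheory GRing.Theory Num.Theory.
Local Open Scope ring_scope.

Lemma F2_eq_neq0 (a : 'F_2) : a = (a != 0)%:R.
Proof. by apply/val_inj; case: a => [[|[|]]]. Qed.

Lemma F2_addrr (a : 'F_2) : a + a = 0.
Proof. by apply/val_inj; case: a => [[|[|]]]. Qed.

Lemma F2_natr_neq0 (k : nat) : (k%:R != 0 :> 'F_2) = odd k.
Proof.
elim: k => [|k IHk] //=; rewrite -natr1 -IHk.
by case: (k%:R) => [[|[|]]].
Qed.

(** Each entry of [x] is 0 or 1, hence the indicator of its own being nonzero, so the entries add up
    to the weight modulo 2. *)
Lemma odd_wt (m : nat) (x : 'rV['F_2]_m) : odd (wt x) = (\sum_j x 0 j != 0).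
Proof.
rewrite -F2_natr_neq0 /wt -sum1_card natr_sum big_mkcond /=.
congr (_ != 0); apply: eq_bigr => j _.
by rewrite inE [RHS]F2_eq_neq0; case: (_ != 0).
Qed.

(** By [odd_wt], even weight is one more linear check, against the all-one row. The transpose
    appears because [kermx] is a left kernel. *)
Lemma even_codeE (n m : nat) (H : 'M['F_2]_(n, m)) :
  even_code H = rowg (kermx (col_mx H (const_mx 1 : 'rV_m))^T).
Proof.
apply/setP => x; rewrite !inE odd_wt negbK.
rewrite (sameP sub_kermxP eqP) tr_col_mx mul_mx_row row_mx_eq0.
rewrite -(trmxK (x *m H^T)) trmx_mul trmxK trmx_eq0; congr (_ && _).
apply/eqP/eqP => [hs|/matrixP/(_ 0 0)].
  apply/matrixP => i j; rewrite !mxE -[RHS]hs.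
  by apply: eq_bigr => k _; rewrite !mxE mulr1 (ord1 i).
rewrite !mxE => hs; rewrite -[RHS]hs.
by apply: eq_bigr => k _; rewrite !mxE mulr1.
Qed.

Lemma hamming_col (n : nat) (H : 'M['F_2]_(n, 2 ^ n - 1)) (c : 'cV['F_2]_n) :
  hamming_check_matrix H -> c != 0 -> exists j, col j H = c.
Proof.
move=> hH c0; have /card_gt0P[j] : (0 < #|[set j | col j H == c]|)%N by rewrite hH c0.
by rewrite inE => /eqP; exists j.
Qed.

(** Let coefficients [a] on the rows of [H] and [b] on the all-one row give zero. Every nonzero [c]
    is a column of [H], so [a *m c] equals [b], signs being immaterial over ['F_2]. Unit vectors
    then show that all entries of [a] equal [b]. *)
Lemma row_free_extended (n : nat) (H : 'M['F_2]_(n, 2 ^ n - 1)) :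
  (2 <= n)%N -> hamming_check_matrix H ->
  row_free (col_mx H (const_mx 1 : 'rV_(2 ^ n - 1))).
Proof.
move=> hn hH; rewrite -kermx_eq0; apply/rowV0P => u /sub_kermxP.
rewrite -(hsubmxK u) mul_row_col; move: (lsubmx u) (rsubmx u) => a b hab.
have aE (c : 'cV['F_2]_n) : c != 0 -> (a *m c) 0 0 = b 0 0.
  move=> /(hamming_col hH)[j <-]; move/matrixP: hab => /(_ 0 j).
  rewrite !mxE big_ord1 mxE mulr1 => /eqP; rewrite addr_eq0 => /eqP.
  have -> : - b 0 0 = b 0 0 by apply/eqP; rewrite eq_sym -addr_eq0 F2_addrr.
  by move=> <-; apply: eq_bigr => k _; rewrite mxE.
have delta_neq0 (k : 'I_n) : delta_mx k 0 != 0 :> 'cV['F_2]_n.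
  by apply/eqP => /matrixP/(_ k 0); rewrite !mxE !eqxx.
have aEb k : a 0 k = b 0 0 by rewrite -(aE _ (delta_neq0 k)) -colE mxE.
(* As [n] is at least 2, there are two distinct unit vectors; their sum is nonzero, hence also a
   column, and it gives [b = b + b = 0]. *)
pose i0 : 'I_n := Ordinal (ltnW hn); pose i1 : 'I_n := Ordinal hn.
have b0 : b 0 0 = 0.
  have c0 : delta_mx i0 0 + delta_mx i1 0 != 0 :> 'cV['F_2]_n.
    by apply/eqP => /matrixP/(_ i0 0); rewrite !mxE !eqxx.
  by rewrite -(aE _ c0) mulmxDr -!colE !mxE !aEb F2_addrr.
apply/rowP => k; rewrite -(splitK k); case: (split k) => l /=.
  by rewrite row_mxEl aEb b0 mxE.
by rewrite row_mxEr (ord1 l) b0 mxE.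
Qed.

Lemma card_even_code (n : nat) (H : 'M['F_2]_(n, 2 ^ n - 1)) :
  (2 <= n)%N -> hamming_check_matrix H ->
  #|even_code H| = (2 ^ (2 ^ n - n - 2))%N.
Proof.
move=> hn hH; rewrite even_codeE card_rowg mxrank_ker mxrank_tr.
have /eqP -> := row_free_extended hn hH.
by rewrite card_Fp // -!subnDA add1n addn1 addn2.
Qed.

Lemma parity_class (p : 'rV['F_2]_2) :
  [set p; parity_bar p] = P_even \/ [set p; parity_bar p] = P_odd.
Proof.
have F2P (a : 'F_2) : {a = 0} + {a = 1}.
  by case: a => [[|[|//]] ha]; [left|right]; apply/val_inj.
have -> : p = bits (p 0 0) (p 0 1).
  apply/rowP => j; rewrite mxE; case: j => [[|[|//]] hj] /=; congr (p 0 _); exact/val_inj.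
have barE (a b : 'F_2) : parity_bar (bits a b) = bits (a + 1) (b + 1).
  by apply/rowP => j; rewrite !mxE; case: ifP.
rewrite barE /P_even /P_odd.
by case: (F2P (p 0 0)) => ->; case: (F2P (p 0 1)) => ->;
  rewrite ?add0r ?F2_addrr; [left|right|right|left]; rewrite // setUC.
Qed.

Lemma parity_bar_neq (p : 'rV['F_2]_2) : parity_bar p != p.
Proof.
rewrite /parity_bar -subr_eq0 addrAC subrr add0r.
by apply/eqP => /matrixP/(_ 0 0); rewrite !mxE.
Qed.

(** The fibre of [u |-> [set u.1; u.2]] over a two-element set consists of its two orderings. *)
Lemma card_ordered_pairs (T : finType) (E : {set {set T}}) :
  (forall e, e \in E -> #|e| = 2%N) ->
  #|[set u : T * T | [set u.1; u.2] \in E]| = (2 * #|E|)%N.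
Proof.
move=> hE; rewrite -sum1_card.
rewrite (partition_big (fun u : T * T => [set u.1; u.2]) [in E]) /=; last first.
  by move=> u; rewrite inE.
rewrite mulnC -sum_nat_const; apply: eq_bigr => e eE.
have /eqP/cards2P[x [y [nxy eE']]] := hE e eE.
have <- : #|[set (x, y); (y, x)]| = 2%N.
  by rewrite cards2 xpair_eqE [y == x]eq_sym andbb nxy.
rewrite sum1dep_card; apply: eq_card => -[a b]; rewrite !inE /= !xpair_eqE.
apply/andP/idP => [[_ /eqP abe]|].
  have : a \in e by rewrite -abe set21.
  have : b \in e by rewrite -abe set22.
  have : x \in [set a; b] by rewrite abe eE' set21.
  have : y \in [set a; b] by rewrite abe eE' set22.
  rewrite eE' !inE => hy hx.
  (* The diagonal choices [a = b] fail: [[set a; b]] would miss [y] or [x]. *)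
  case/orP => /eqP hb; case/orP => /eqP ha; subst a b; rewrite ?eqxx ?orbT //.
    by move: hy; rewrite orbb eq_sym (negPf nxy).
  by move: hx; rewrite orbb (negPf nxy).
case/orP => /andP[/eqP -> /eqP ->]; first by rewrite -eE' eqxx.
by rewrite [[set y; x]]setUC -eE' eqxx.
Qed.

Section CutVector.
Variables (m : nat) (S : {set 'rV['F_2]_m}).
Variables (v : 'I_#|S| -> 'rV['F_2]_m) (hv : enumeration v) (p : 'rV['F_2]_2).
Implicit Type pi : 'rV['F_2]_m -> 'rV['F_2]_2.

Lemma edges4P e : e \in edges4 S ->
  exists x y, [/\ x \in S, y \in S, x != y & e = [set x; y]].
Proof.
case/imset2P => x y xS; rewrite inE => /andP[yS /eqP hd] ->; exists x, y; split=> //.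
apply/eqP => xy; move: hd; rewrite xy /dH => /eqP.
by rewrite -[_ == _]negbK => /negP[]; rewrite eq_card0 // => j; rewrite inE eqxx.
Qed.

Lemma card_edge4 e : e \in edges4 S -> #|e| = 2%N.
Proof. by case/edges4P => x [y [_ _ nxy ->]]; rewrite cards2 nxy. Qed.

Lemma pair_edge4_in x y : [set x; y] \in edges4 S -> (x \in S) && (y \in S).
Proof.
case/edges4P => a [b [aS bS _ hE]].
have : x \in [set a; b] by rewrite -hE set21.
have : y \in [set a; b] by rewrite -hE set22.
by rewrite !inE => /orP[]/eqP -> /orP[]/eqP ->; rewrite ?aS ?bS.
Qed.

Lemma pair_same_parity pi x y :
  ([set x; y] \in same_parity_edges S pi) =
  ([set x; y] \in edges4 S) && (pi x == pi y).
Proof.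
rewrite inE; congr (_ && _); apply/idP/eqP => [|hxy].
  by move=> /forall_inP/(_ x (set21 x y))/forall_inP/(_ y (set22 x y))/eqP.
apply/forall_inP => a /set2P ha; apply/forall_inP => b /set2P hb.
by case: ha => ->; case: hb => ->; rewrite ?hxy.
Qed.

(** Turns matrix sums over indices into sums over codewords, where the ordering [v] disappears. *)
Lemma sum_enumeration (F : 'rV['F_2]_m -> int) : \sum_i F (v i) = \sum_(x in S) F x.
Proof.
case: hv => v_inj vS.
have SE : S = v @: setT.
  apply/setP => x; apply/idP/imsetP => [/vS[i <-]|[i _ ->]]; first by exists i.
  by apply/vS; exists i.
rewrite [RHS](eq_bigl [in v @: setT]) => [|x]; last by rewrite -SE.
by rewrite big_imset /=; [apply: eq_bigl => i; rewrite inE | move=> i j _ _ /v_inj].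
Qed.

(** Stated for any set of edges so as to serve both for all edges and for the same-parity ones. *)
Lemma sum_pairs_card (E : {set {set 'rV['F_2]_m}}) : E \subset edges4 S ->
  \sum_(x in S) \sum_(y in S) ([set x; y] \in E)%:R = 2 * #|E|%:R :> int.
Proof.
move=> /subsetP sE.
rewrite -natrM -(card_ordered_pairs (fun e eE => card_edge4 (sE e eE))).
rewrite -sum1_card natr_sum [RHS]big_mkcond pair_big [LHS]big_mkcond /=.
apply: eq_bigr => -[x y] _ /=; rewrite inE /=.
by case: ifP; case: (boolP (_ \in E)) => // /sE/pair_edge4_in ->.
Qed.

Lemma quad_form_cut_vector pi : parity_assignment S p pi ->
  quad_form (adjacency4 v) (cut_vector v p pi) =
  4 * #|same_parity_edges S pi|%:R - 2 * #|edges4 S|%:R.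
Proof.
move=> hpi; pose s x : int := if pi x == p then 1 else -1.
have sE x y : x \in S -> y \in S -> s x * s y = 2 * (pi x == pi y)%:R - 1.
  move=> /hpi/set2P hx /hpi/set2P hy; rewrite /s.
  case: hx => ->; case: hy => ->;
    by rewrite ?eqxx ?[p == parity_bar p]eq_sym ?(negPf (parity_bar_neq p)).
transitivity (\sum_(x in S) \sum_(y in S) ([set x; y] \in edges4 S)%:R * (s x * s y)).
  rewrite -sum_enumeration /quad_form -mulmxA mxE; apply: eq_bigr => i _.
  rewrite -sum_enumeration !mxE mulr_sumr; apply: eq_bigr => j _.
  by rewrite !mxE -/(s _) -/(s _) mulrCA.
(* By [sE] the sign product is affine in the same-parity indicator, which multiplied by the edge
   indicator marks same-parity edges. Passing from ordered pairs to edges then doubles the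
   coefficients 2 and 1. *)
transitivity (\sum_(x in S) \sum_(y in S)
    (2 * ([set x; y] \in same_parity_edges S pi)%:R - ([set x; y] \in edges4 S)%:R) : int).
  apply: eq_bigr => x xS; apply: eq_bigr => y yS.
  by rewrite sE // pair_same_parity; case: (_ \in _) => //=; rewrite ?mul0r ?mul1r.
under eq_bigr => x _ do rewrite sumrB -mulr_sumr.
rewrite sumrB -mulr_sumr !sum_pairs_card //; first by ring.
by apply/subsetP => e; rewrite inE => /andP[].
Qed.

Lemma cut_vector_sign pi : sign_vector (cut_vector v p pi).
Proof. by move=> i; rewrite mxE; case: ifP; [left|right]. Qed.

Lemma sign_vector_cut (w : 'cV[int]_#|S|) : sign_vector w ->
  exists2 pi, parity_assignment S p pi & cut_vector v p pi = w.
Proof.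
move=> hw.
(* The assignment acts on vectors rather than indices, so [v] has to be inverted: [x] gets [p] when
   an index of [x] carries sign 1. Injectivity of [v] makes that index unique. *)
exists (fun x => if [exists i, (v i == x) && (w i 0 == 1)] then p else parity_bar p).
  by move=> x _; case: ifP; rewrite ?set21 ?set22.
apply/colP => i; rewrite mxE.
case: existsP => [[j /andP[/eqP/hv.1 -> /eqP ->]]|hn]; first by rewrite eqxx.
rewrite (negPf (parity_bar_neq p)); case: (hw i) => // wi.
by case: hn; exists i; rewrite wi !eqxx.
Qed.

(** The number of edges is the same for all assignments and the factor 4 is positive, so the
    quadratic form orders cut vectors as the same-parity count orders assignments; [sign_vector_cut]
    extends the comparison to all sign vectors. *)
Lemma minimizes_same_parity_quad_form pi : parity_assignment S p pi ->
  minimizes_same_parity S p pi <->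
  minimizes_quad_form (adjacency4 v) (cut_vector v p pi).
Proof.
move=> hpi.
have le_same pi' : parity_assignment S p pi' ->
    (quad_form (adjacency4 v) (cut_vector v p pi) <=
     quad_form (adjacency4 v) (cut_vector v p pi')) =
    (#|same_parity_edges S pi| <= #|same_parity_edges S pi'|)%N.
  by move=> hpi'; rewrite !quad_form_cut_vector // lerD2r ler_pM2l // ler_nat.
split=> -[_ hmin]; split=> //; first exact: cut_vector_sign.
  by move=> w /sign_vector_cut[pi' hpi' <-]; rewrite le_same // hmin.
by move=> pi' hpi'; rewrite -le_same // hmin //; apply: cut_vector_sign.
Qed.

End CutVector.

Theorem theorem3 (n : nat) (hn : (2 <= n)%N)
    (H : 'M['F_2]_(n, 2 ^ n - 1)) (hH : hamming_check_matrix H)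
    (v : 'I_#|even_code H| -> 'rV['F_2]_(2 ^ n - 1)) (hv : enumeration v)
    (p : 'rV['F_2]_2)
    (pi : 'rV['F_2]_(2 ^ n - 1) -> 'rV['F_2]_2)
    (hpi : parity_assignment (even_code H) p pi) :
  [/\ #|even_code H| = (2 ^ (2 ^ n - n - 2))%N,
      [set p; parity_bar p] = P_even \/ [set p; parity_bar p] = P_odd &
      minimizes_same_parity (even_code H) p pi <->
      minimizes_quad_form (adjacency4 v) (cut_vector v p pi)].
Proof.
split; first exact: card_even_code.
  exact: parity_class.
exact: minimizes_same_parity_quad_form.
Qed.
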